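(* Let $(L,A,[\,,\,,\,]_L,\phi,\alpha,\rho)$ be a split regular Hom 3-Lie-Rinehart algebra with splitting Cartan subalgebra $H$, root system $\Gamma$ of $L$ and weight system $\Lambda$ of $A$ associated to $H$. For any $\gamma,\gamma_1,\gamma_2,\gamma_3\in\Gamma\cup\{0\}$ and $\lambda,\lambda_1,\lambda_2\in\Lambda\cup\{0\}$ the following assertions hold: 1) if $\lambda\in\Lambda$, then for all $k\in\mathbb Z$, $\lambda(\alpha^k,\alpha^k)\in\Lambda$ and $\phi^k(A_\lambda)=A_{\lambda(\alpha^{-k},\alpha^{-k})}$; 2) if $\gamma\in\Gamma$, then for all $k\in\mathbb Z$, $\gamma(\alpha^k,\alpha^k)\in\Gamma$ and $\alpha^k(L_\gamma)=L_{\gamma(\alpha^{-k},\alpha^{-k})}$; 3) if $[L_{\gamma_1},L_{\gamma_2},L_{\gamma_3}]_L\neq 0$, then $(\gamma_1+\gamma_2+\gamma_3)(\alpha^{-1},\alpha^{-1})\in\Gamma\cup\{0\}$ and $[L_{\gamma_1},L_{\gamma_2},L_{\gamma_3}]_L\subset L_{(\gamma_1+\gamma_2+\gamma_3)(\alpha^{-1},\alpha^{-1})}$; 4) if $A_{\lambda_1}A_{\lambda_2}\neq 0$, then $\lambda_1+\lambda_2\in\Lambda\cup\{0\}$ and $A_{\lambda_1}A_{\lambda_2}\subset A_{\lambda_1+\lambda_2}$; 5) if $A_\lambda L_\gamma\neq 0$, then $\lambda+\gamma\in\Gamma\cup\{0\}$ and $A_\lambda L_\gamma\subset L_{\lambda+\gamma}$;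 6) if $\rho(L_{\gamma_1},L_{\gamma_2})(A_\lambda)\neq 0$, then $(\gamma_1+\gamma_2+\lambda)(\alpha^{-1},\alpha^{-1})\in\Lambda\cup\{0\}$ and $\rho(L_{\gamma_1},L_{\gamma_2})(A_\lambda)\subset A_{(\gamma_1+\gamma_2+\lambda)(\alpha^{-1},\alpha^{-1})}$.
   Context: $F$ is a field of characteristic zero, all vector spaces and algebras are over $F$, and $A$ is a commutative associative $F$-algebra. A multiplicative Hom 3-Lie algebra $(L,[\,,\,,\,]_L,\alpha)$ is a vector space $L$ with a linear map $[\,,\,,\,]_L:\wedge^3L\to L$ and a linear map $\alpha:L\to L$ such that $\alpha([x,y,z]_L)=[\alpha(x),\alpha(y),\alpha(z)]_L$ and $[\alpha(x_1),\alpha(x_2),[x_3,x_4,x_5]_L]_L=[[x_1,x_2,x_3]_L,\alpha(x_4),\alpha(x_5)]_L+[\alpha(x_3),[x_1,x_2,x_4]_L,\alpha(x_5)]_L+[\alpha(x_3),\alpha(x_4),[x_1,x_2,x_5]_L]_L$ for all elements of $L$. A representation of it is a triple $(V,\phi,\rho)$ (also written $(V,\rho,\phi)$) with $V$ a vector space, $\rho:L\wedge L\to gl(V)$ and $\phi:V\to V$ linear, such that for all $x_i\in L$: $\rho(\alpha(x_1),\alpha(x_2))\phi=\phi\rho(x_1,x_2)$; $\rho([x_1,x_2,x_3]_L,\alpha(x_4))\phi=\rho(\alpha(x_1),\alpha(x_2))\rho(x_3,x_4)+\rho(\alpha(x_2),\alpha(x_3))\rho(x_1,x_4)+\rho(\alpha(x_3),\alpha(x_1))\rho(x_2,x_4)$;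 $\rho(\alpha(x_1),\alpha(x_2))\rho(x_3,x_4)=\rho(\alpha(x_3),\alpha(x_4))\rho(x_1,x_2)+\rho([x_1,x_2,x_3]_L,\alpha(x_4))\phi+\rho(\alpha(x_3),[x_1,x_2,x_4]_L)\phi$. For an algebra endomorphism $\phi$ of $A$, $Der_\phi(A)$ is the set of linear maps $D:A\to A$ with $D(ab)=\phi(a)D(b)+D(a)\phi(b)$. A Hom 3-Lie-Rinehart algebra $(L,A,[\,,\,,\,]_L,\phi,\alpha,\rho)$ consists of a multiplicative Hom 3-Lie algebra $(L,[\,,\,,\,]_L,\alpha)$ with $L$ an $A$-module, an algebra homomorphism $\phi:A\to A$ and a linear map $\rho:L\wedge L\to Der_\phi(A)$ such that $(A,\rho,\phi)$ is a representation of $(L,[\,,\,,\,]_L,\alpha)$ and, for all $a\in A$, $x,y,z\in L$: $\alpha(ax)=\phi(a)\alpha(x)$, $[x,y,az]_L=\phi(a)[x,y,z]_L+\rho(x,y)(a)\alpha(z)$, $\rho(ax,y)=\rho(x,ay)=\phi(a)\rho(x,y)$. It is regular if $\alpha$ and $\phi$ are algebra automorphisms. A regular Hom 3-Lie-Rinehart algebra is called split if there is a maximal abelian subalgebra $H$ of the Hom 3-Lie algebra $L$ (abelian: $[H,H,H]_L=0$) with $\alpha(H)=H$ and $L=H\oplus\bigoplus_{\gamma\in\Gamma}L_\gamma$, $A=A_0\oplus\bigoplus_{\lambda\in\Lambda}A_\lambda$, where for $\gamma,\lambda\in(H\wedge H)^*$, $L_\gamma=\{x\in L\mid [h_1,h_2,x]_L=\gamma(h_1,h_2)\alpha(x)\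 \forall h_1,h_2\in H\}$, $L_0=H$, $A_\lambda=\{a\in A\mid \rho(h_1,h_2)(a)=\lambda(h_1,h_2)\phi(a)\ \forall h_1,h_2\in H\}$, $A_0=\{a\in A\mid\rho(H,H)(a)=0\}$, $\Gamma=\{\gamma\in(H\wedge H)^*\setminus\{0\}\mid L_\gamma\neq0\}$, $\Lambda=\{\lambda\in(H\wedge H)^*\setminus\{0\}\mid A_\lambda\neq0\}$. $H$ is called a splitting Cartan subalgebra, $\Gamma$ the root system of $L$, $\Lambda$ the weight system of $A$ (associated to $H$). For $\gamma\in(H\wedge H)^*$ and $k\in\mathbb Z$, $\gamma(\alpha^k,\alpha^k)$ is the functional $(h_1,h_2)\mapsto\gamma(\alpha^k(h_1),\alpha^k(h_2))$. Products, brackets and $\rho(\cdot,\cdot)(\cdot)$ of subspaces denote linear spans. *)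

(* Defs.v *)
From HB Require Import structures.
From mathcomp Require Import all_boot all_order all_algebra.
From mathcomp Require Import all_classical.

Set Implicit Arguments.
Unset Strict Implicit.
Unset Printing Implicit Defensive.

Import GRing.Theory.
Local Open Scope classical_set_scope.
Local Open Scope ring_scope.

Section LinearAlgebra.
Context {F : fieldType}.
Implicit Types U V W : lmodType F.

Definition bilin U V W (f : U -> V -> W) : Prop := bilinear_for *:%R *:%R f.

(* A linear map U /\ U -> W. *)
Definition alternating2 U W (f : U -> U -> W) : Prop :=
  bilin f /\ (forall x, f x x = 0).

(* A linear map U /\ U /\ U -> W; vanishing on x, y, x follows. *)
Definition alternating3 U W (f : U -> U -> U -> W) : Prop :=
  [/\ forall y z, linear (fun x => f x y z),
      forall x z, linear (fun y => f x y z),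
      forall x y, linear (fun z => f x y z),
      forall x y, f x x y = 0 &
      forall x y, f x y y = 0].

Definition lspan V (S : set V) : set V :=
  smallest (fun W : set V => submod_closed (mem W)) S.

(* V is the (internal) direct sum of the subspaces X i, i in D: every vector is
   in a unique way a sum of a finitely supported family of elements of them. *)
Definition is_direct_sum (I : choiceType) V (D : set I) (X : I -> set V) : Prop :=
  forall v, exists! f : I -> V,
    [/\ forall i, D i -> X i (f i), forall i, ~ D i -> f i = 0,
        finite_set [set i | f i <> 0] & v = \sum_(i \in D) f i].

(* f ^ k for an integer k. The partial inverse 'pinv_ is the inverse of f as
   soon as f is bijective, and zpow is only used for such f. *)
Definition zpow V (f : V -> V) (k : int) : V -> V :=
  match k with
  | Posz n => iter n f
  | Negz n => iter n.+1 ('pinv_(fun=> 0) [set: V] f)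
  end.

Definition sub_of V (H : submodClosed V) : Type := {x : V | x \in H}.

End LinearAlgebra.

HB.instance Definition _ (F : fieldType) (V : lmodType F) (H : submodClosed V) :=
  SubChoice.on (sub_of H).
HB.instance Definition _ (F : fieldType) (V : lmodType F) (H : submodClosed V) :=
  [SubChoice_isSubLmodule of sub_of H by <:].

Section HomLieRinehart.
Context {F : fieldType}.

(* A commutative associative algebra, not assumed to have a unit. *)
Record is_comm_assoc_algebra (A : lmodType F) (mul : A -> A -> A) : Prop := {
  calg_bilin : bilin mul;
  calg_assoc : associative mul;
  calg_comm : commutative mul }.

Record is_module (A L : lmodType F) (mul : A -> A -> A) (act : A -> L -> L)
    : Prop := {
  mod_bilin : bilin act;
  mod_assoc : forall a b x, act (mul a b) x = act a (act b x) }.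

Record is_hom_3lie (L : lmodType F) (br : L -> L -> L -> L)
    (alpha : {linear L -> L}) : Prop := {
  h3l_alternating : alternating3 br;
  h3l_mult : forall x y z,
    alpha (br x y z) = br (alpha x) (alpha y) (alpha z);
  h3l_jacobi : forall x1 x2 x3 x4 x5,
    br (alpha x1) (alpha x2) (br x3 x4 x5) =
      br (br x1 x2 x3) (alpha x4) (alpha x5)
      + br (alpha x3) (br x1 x2 x4) (alpha x5)
      + br (alpha x3) (alpha x4) (br x1 x2 x5) }.

Record is_hom_rep (L V : lmodType F) (br : L -> L -> L -> L)
    (alpha : {linear L -> L}) (phi : {linear V -> V})
    (rho : L -> L -> V -> V) : Prop := {
  rep_alternating : alternating2 rho;
  rep_linear : forall x y, linear (rho x y);
  rep_twist : forall x1 x2 v,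
    rho (alpha x1) (alpha x2) (phi v) = phi (rho x1 x2 v);
  rep_cyclic : forall x1 x2 x3 x4 v,
    rho (br x1 x2 x3) (alpha x4) (phi v) =
      rho (alpha x1) (alpha x2) (rho x3 x4 v)
      + rho (alpha x2) (alpha x3) (rho x1 x4 v)
      + rho (alpha x3) (alpha x1) (rho x2 x4 v);
  rep_jacobi : forall x1 x2 x3 x4 v,
    rho (alpha x1) (alpha x2) (rho x3 x4 v) =
      rho (alpha x3) (alpha x4) (rho x1 x2 v)
      + rho (br x1 x2 x3) (alpha x4) (phi v)
      + rho (alpha x3) (br x1 x2 x4) (phi v) }.

(* Der_phi(A) *)
Definition is_derivation (A : lmodType F) (mul : A -> A -> A)
    (phi : {linear A -> A}) (D : A -> A) : Prop :=
  linear D /\ forall a b, D (mul a b) = mul (phi a) (D b) + mul (D a) (phi b).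

Record is_hom_3lie_rinehart (A L : lmodType F) (mul : A -> A -> A)
    (act : A -> L -> L) (br : L -> L -> L -> L) (phi : {linear A -> A})
    (alpha : {linear L -> L}) (rho : L -> L -> A -> A) : Prop := {
  hlr_algebra : is_comm_assoc_algebra mul;
  hlr_hom_3lie : is_hom_3lie br alpha;
  hlr_module : is_module mul act;
  hlr_phi_mult : {morph phi : a b / mul a b};
  hlr_derivation : forall x y, is_derivation mul phi (rho x y);
  hlr_rep : is_hom_rep br alpha phi rho;
  hlr_alpha_act : forall a x, alpha (act a x) = act (phi a) (alpha x);
  hlr_leibniz : forall a x y z,
    br x y (act a z) = act (phi a) (br x y z) + act (rho x y a) (alpha z);
  hlr_rho_actl : forall a x y b, rho (act a x) y b = mul (phi a) (rho x y b);
  hlr_rho_actr : forall a x y b, rho x (act a y) b = mul (phi a) (rho x y b) }.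

Definition is_regular_hom_3lie_rinehart (A L : lmodType F) (mul : A -> A -> A)
    (act : A -> L -> L) (br : L -> L -> L -> L) (phi : {linear A -> A})
    (alpha : {linear L -> L}) (rho : L -> L -> A -> A) : Prop :=
  [/\ is_hom_3lie_rinehart mul act br phi alpha rho,
      bijective alpha & bijective phi].

Section Subalgebras.
Variables (L : lmodType F) (br : L -> L -> L -> L) (alpha : {linear L -> L}).

Definition is_subalgebra (K : submodClosed L) : Prop :=
  (forall x y z, x \in K -> y \in K -> z \in K -> br x y z \in K) /\
  (forall x, x \in K -> alpha x \in K).

Definition is_abelian (K : submodClosed L) : Prop :=
  forall x y z, x \in K -> y \in K -> z \in K -> br x y z = 0.

Definition is_max_abelian (H : submodClosed L) : Prop :=
  [/\ is_subalgebra H, is_abelian H &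
      forall K : submodClosed L, is_subalgebra K -> is_abelian K ->
        {subset H <= K} -> K =i H].

End Subalgebras.

Section Roots.
Variables (A L : lmodType F) (br : L -> L -> L -> L) (phi : {linear A -> A})
  (alpha : {linear L -> L}) (rho : L -> L -> A -> A) (H : submodClosed L).

(* (H /\ H)^*, as a set of functions on H x H, added pointwise. *)
Definition wedge_dual : set (sub_of H -> sub_of H -> F) :=
  [set g | alternating2 (g : sub_of H -> sub_of H -> F^o)].

Implicit Type g : sub_of H -> sub_of H -> F.

Definition root_space g : set L :=
  [set x | forall h1 h2 : sub_of H,
     br (val h1) (val h2) x = g h1 h2 *: alpha x].

Definition weight_space g : set A :=
  [set a | forall h1 h2 : sub_of H,
     rho (val h1) (val h2) a = g h1 h2 *: phi a].

Definition root_system : set (sub_of H -> sub_of H -> F) :=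
  [set g | [/\ wedge_dual g, g <> 0 & root_space g <> [set 0]]].

Definition weight_system : set (sub_of H -> sub_of H -> F) :=
  [set g | [/\ wedge_dual g, g <> 0 & weight_space g <> [set 0]]].

(* alpha ^ k restricted to H; the default value 0 of insubd is never used when
   alpha is injective and alpha(H) = H. *)
Definition zpow_on (k : int) (h : sub_of H) : sub_of H :=
  insubd 0 (zpow alpha k (val h)).

(* g(alpha ^ k, alpha ^ k) *)
Definition twist g (k : int) : sub_of H -> sub_of H -> F :=
  fun h1 h2 => g (zpow_on k h1) (zpow_on k h2).

End Roots.

End HomLieRinehart.

Arguments root_space {F L} br alpha H g : rename.
Arguments weight_space {F A L} phi rho H g : rename.
Arguments root_system {F L} br alpha H : rename.
Arguments weight_system {F A L} phi rho H : rename.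

(* H is a splitting Cartan subalgebra of the regular Hom 3-Lie-Rinehart algebra.
   The index 0 of the two direct sums stands for the summands H = L_0 and
   A_0 = {a | rho(H, H)(a) = 0}. *)
Record is_split_regular (F : fieldType) (A L : lmodType F) (mul : A -> A -> A)
    (act : A -> L -> L) (br : L -> L -> L -> L) (phi : {linear A -> A})
    (alpha : {linear L -> L}) (rho : L -> L -> A -> A) (H : submodClosed L)
    : Prop := {
  split_regular : is_regular_hom_3lie_rinehart mul act br phi alpha rho;
  split_max_abelian : is_max_abelian br alpha H;
  split_alphaH : alpha @` [set` H] = [set` H];
  split_root0 : root_space br alpha H 0 = [set` H];
  split_L : is_direct_sum (0 |` root_system br alpha H) (root_space br alpha H);
  split_A : is_direct_sum (0 |` weight_system phi rho H) (weight_space phi rho H) }.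

(* Main.v *)
Require Import Defs.
From mathcomp Require Import all_boot all_order all_algebra.
From mathcomp Require Import all_classical.

Set Implicit Arguments.
Unset Strict Implicit.
Unset Printing Implicit Defensive.

Import GRing.Theory.
Local Open Scope classical_set_scope.
Local Open Scope ring_scope.

(** Root spaces and weight spaces are the same construction: both are
simultaneous twisted eigenspaces
  V_g = {v | T h1 h2 v = g(h1, h2) phi(v) for all h1, h2 in H}
of a family of operators T x y on a space V with an automorphism phi, where T
is the bracket and phi is alpha for the roots, and T is rho for the weights.
All six assertions follow from three identities satisfied by both families.

- Equivariance, T (alpha x) (alpha y) (phi v) = phi (T x y v), shows that
  phi^k carries V_g into V_(g(alpha^-k, alpha^-k)). The power -k carries that
  space back, so the inclusion is an equality, and g(alpha^k, alpha^k) is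
  again a nonzero functional with nonzero eigenspace (assertions 1 and 2).

- The Jacobi identity, which expresses T (alpha x1) (alpha x2) on T x3 x4 v by
  letting (x1, x2) act on v, on x3 and on x4 in turn, makes the eigenvalues
  add up. It only speaks of pairs in the image of alpha; as alpha(H) = H this
  is harmless, and it is the origin of the twist by alpha^-1 (assertions 3
  and 6). For the bracket it is the fundamental identity, and the operators
  x |-> [x1, x2, x] form the adjoint action.

- The twisted Leibniz rule for a product A x V -> V adds eigenvalues with no
  twist (assertions 4 and 5).

In the last four assertions the generators of a span lie in one eigenspace,
which is a subspace, so the span does; when the span is nonzero the eigenspace
is nonzero too, so its functional, which is bilinear and alternating, is 0 or
a root (or weight). *)

(** * Integer powers of a linear bijection *)

Section Powers.
Context {F : fieldType}.
Implicit Types U V : lmodType F.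

Lemma bij_pinvK V (f : V -> V) : bijective f ->
  cancel f ('pinv_(fun=> 0) [set: V] f) /\
  cancel ('pinv_(fun=> 0) [set: V] f) f.
Proof.
move=> bf; split=> x.
  by rewrite pinvKV ?inE//; exact: in2W (bij_inj bf).
have [g _ gK] := bf.
by rewrite pinvK// inE; exists (g x).
Qed.

Lemma iter_cancel (T : Type) (f g : T -> T) n :
  cancel f g -> cancel (iter n f) (iter n g).
Proof.
by move=> fK; elim: n => // n IH x; rewrite [LHS]iterSr iterS fK IH.
Qed.

Lemma zpowK V (f : V -> V) (k : int) : bijective f ->
  cancel (zpow f k) (zpow f (- k)).
Proof.
move=> /bij_pinvK[fK fVK]; case: k => [[|n]|n].
- by [].
- by move=> x; rewrite -NegzE; exact: (iter_cancel n.+1 fK).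
- by rewrite NegzE opprK => x; rewrite -NegzE; exact: (iter_cancel n.+1 fVK).
Qed.

Lemma zpowKV V (f : V -> V) (k : int) : bijective f ->
  cancel (zpow f (- k)) (zpow f k).
Proof. by move=> bf x; rewrite -{1}[k]opprK zpowK. Qed.

Lemma pinv_linear V (f : {linear V -> V}) : bijective f ->
  linear ('pinv_(fun=> 0) [set: V] f).
Proof.
move=> /[dup] bf /bij_pinvK[fK fVK] a x y; apply: (bij_inj bf).
by rewrite linearP !fVK.
Qed.

Lemma zpow_linear V (f : {linear V -> V}) (k : int) : bijective f ->
  linear (zpow f k).
Proof.
move=> bf; case: k => n a x y /=.
  by elim: n => //= n ->; rewrite linearP.
rewrite -pinv_linear//; congr ('pinv_(fun=> 0) [set: V] f _).
by elim: n => //= n ->; rewrite pinv_linear.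
Qed.

Lemma zpow_stable V (f : V -> V) (X : set V) (k : int) : bijective f ->
  f @` X = X -> forall x, X x -> X (zpow f k x).
Proof.
move=> /bij_pinvK[fK fVK] fX x Xx.
have fS y : X y -> X (f y) by move=> Xy; rewrite -fX; exists y.
have fVS y : X y -> X ('pinv_(fun=> 0) [set: V] f y).
  by rewrite -{1}fX => -[z Xz <-]; rewrite fK.
case: k => n; rewrite /zpow; first by elim: n => //= n /fS.
by elim: n.+1 => //= m /fVS.
Qed.

Lemma zpow_comm V (f : V -> V) (k : int) x : bijective f ->
  zpow f k (f x) = f (zpow f k x).
Proof.
move=> /bij_pinvK[fK fVK]; case: k => n; first by rewrite /zpow -iterSr.
by rewrite /zpow iterSr fK /= fVK.
Qed.

Lemma zpow_equivariant U V (f : U -> U) (p : V -> V) (T : U -> U -> V -> V)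
    (k : int) : bijective f -> bijective p ->
  (forall x y v, T (f x) (f y) (p v) = p (T x y v)) ->
  forall x y v,
    T (zpow f k x) (zpow f k y) (zpow p k v) = zpow p k (T x y v).
Proof.
move=> /bij_pinvK[fK fVK] /[dup] bp /bij_pinvK[pK pVK] Tfp x y v.
set fV := 'pinv_(fun=> 0) [set: U] f in fK fVK *.
set pV := 'pinv_(fun=> 0) [set: V] p in pK pVK *.
have TfV x1 y1 v1 : T (fV x1) (fV y1) (pV v1) = pV (T x1 y1 v1).
  by apply: (bij_inj bp); rewrite -Tfp !fVK !pVK.
case: k => n; rewrite /zpow -/fV -/pV.
  by elim: n => //= n IH; rewrite Tfp IH.
by elim: n.+1 => //= m IH; rewrite TfV IH.
Qed.

Lemma linear_fun0 U V (f : U -> V) : linear f -> f 0 = 0.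
Proof.
by move=> fL; have := fL (- 1) 0 0; rewrite scaler0 addr0 scaleN1r addNr.
Qed.

Lemma linear_funZ U V (f : U -> V) a x : linear f -> f (a *: x) = a *: f x.
Proof. by move=> fL; have := fL a x 0; rewrite !addr0 linear_fun0// addr0. Qed.

End Powers.

(** * Twisted functionals on H x H *)

Section Twist.
Context {F : fieldType} {L : lmodType F} {alpha : {linear L -> L}}
  {H : submodClosed L}.
Hypothesis alpha_bij : bijective alpha.
Hypothesis alphaH : alpha @` [set` H] = [set` H].
Implicit Types (g : sub_of H -> sub_of H -> F) (h : sub_of H) (k : int).

Lemma val_zpow_on k h : val (zpow_on alpha k h) = zpow alpha k (val h).
Proof.
by rewrite insubdK//; exact: (zpow_stable _ alpha_bij alphaH (valP h)).
Qed.

Lemma zpow_onK k : cancel (zpow_on alpha k) (@zpow_on _ _ alpha H (- k)).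
Proof. by move=> h; apply: val_inj; rewrite !val_zpow_on zpowK. Qed.

Lemma zpow_on_linear k : linear (@zpow_on _ _ alpha H k).
Proof.
move=> a h1 h2; apply: val_inj.
rewrite GRing.valD GRing.valZ !val_zpow_on GRing.valD GRing.valZ.
exact: zpow_linear.
Qed.

Lemma twistKV g k : twist alpha (twist alpha g (- k)) k = g.
Proof. by apply/funext => h1; apply/funext => h2; rewrite /twist !zpow_onK. Qed.

Lemma alpha_zpow_onN1 h : alpha (val (zpow_on alpha (- 1) h)) = val h.
Proof. by rewrite val_zpow_on; exact: (zpowKV 1 alpha_bij). Qed.

Lemma wedge_dual_twist g k : wedge_dual g -> wedge_dual (twist alpha g k).
Proof.
move=> [[gl gr] galt]; split; last by move=> h; exact: galt.
split=> h a h1 h2; rewrite /twist zpow_on_linear; [exact: gl|exact: gr].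
Qed.

Lemma wedge_dual0 : @wedge_dual _ _ H 0.
Proof.
by split=> //; split=> h a h1 h2; exact: esym (etrans (addr0 _) (scaler0 _ a)).
Qed.

Lemma wedge_dualD g1 g2 : wedge_dual g1 -> wedge_dual g2 ->
  wedge_dual (g1 + g2).
Proof.
move=> [[g1l g1r] g1alt] [[g2l g2r] g2alt]; split; last first.
  by move=> h; rewrite !fctE g1alt g2alt addr0.
split=> h a h1 h2; rewrite !fctE.
  by rewrite g1l g2l addrACA; congr (_ + _); exact: esym (mulrDr _ _ _).
by rewrite g1r g2r addrACA; congr (_ + _); exact: esym (mulrDr _ _ _).
Qed.

End Twist.

(** * Eigenspaces of a family of operators *)

Section Eigenspaces.
Context {F : fieldType} {L V : lmodType F} {phi : {linear V -> V}}
  {T : L -> L -> V -> V} {H : submodClosed L}.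
Hypothesis T_linear : forall x y, linear (T x y).
Implicit Type g : sub_of H -> sub_of H -> F.

Lemma weight_space_submod g : submod_closed (mem (weight_space phi T H g)).
Proof.
split=> [|a u v]; rewrite !inE.
  by move=> h1 h2; rewrite linear0 scaler0 linear_fun0.
move=> gu gv h1 h2; rewrite T_linear linearP gu gv scalerDr !scalerA.
by rewrite [a * _]mulrC.
Qed.

Lemma weight_system_wedge g :
  (0 |` weight_system phi T H) g -> wedge_dual g.
Proof. by move=> [->|[]//]; exact: wedge_dual0. Qed.

(** This reduces each assertion about a product of eigenspaces to its
generators: an eigenspace is a subspace, so it contains the whole span, and
a nonzero span makes it nonzero, hence makes g zero or a root (weight). *)
Lemma lspan_weight_space g (S : set V) : wedge_dual g ->
  S `<=` weight_space phi T H g -> lspan S <> [set 0] ->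
  (0 |` weight_system phi T H) g /\ lspan S `<=` weight_space phi T H g.
Proof.
move=> gw Sg S_neq0.
have spanS : lspan S `<=` weight_space phi T H g.
  exact: smallest_sub (weight_space_submod g) Sg.
split=> //; have [->|/eqP g_neq0] := eqVneq g 0; [by left|right].
split=> // g0; apply: S_neq0; apply/seteqP; split=> [u|_ ->].
  by rewrite -g0; exact: spanS.
by move=> W [[W0 _] _]; rewrite inE in W0.
Qed.

End Eigenspaces.

(** * The action of the powers of the twisting map *)

Section Equivariance.
Context {F : fieldType} {L V : lmodType F} {alpha : {linear L -> L}}
  {phi : {linear V -> V}} {T : L -> L -> V -> V} {H : submodClosed L}.
Hypotheses (alpha_bij : bijective alpha) (phi_bij : bijective phi).
Hypothesis alphaH : alpha @` [set` H] = [set` H].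
Hypothesis T_equivariant :
  forall x y v, T (alpha x) (alpha y) (phi v) = phi (T x y v).
Implicit Type g : sub_of H -> sub_of H -> F.

(** The value of the twisted functional at (h1, h2) is that of g at
(alpha^-k h1, alpha^-k h2), and equivariance of the k-th powers carries the
eigenvalue equation at the latter pair to one at (h1, h2). *)
Lemma zpow_weight_space_sub g (k : int) v : weight_space phi T H g v ->
  weight_space phi T H (twist alpha g (- k)) (zpow phi k v).
Proof.
move=> gv h1 h2; rewrite /twist.
set h1' := zpow_on _ _ h1; set h2' := zpow_on _ _ h2.
have val_h (h : sub_of H) : val h = zpow alpha k (val (zpow_on alpha (- k) h)).
  by rewrite val_zpow_on// zpowKV.
rewrite (val_h h1) (val_h h2) (zpow_equivariant k alpha_bij phi_bij)// gv.
by rewrite linear_funZ ?zpow_comm//; exact: zpow_linear.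
Qed.

Lemma zpow_weight_space g (k : int) :
  zpow phi k @` weight_space phi T H g
  = weight_space phi T H (twist alpha g (- k)).
Proof.
apply/seteqP; split=> [_ [v gv <-]|v gv]; first exact: zpow_weight_space_sub.
exists (zpow phi (- k) v); last exact: zpowKV.
have := zpow_weight_space_sub (- k) gv.
by rewrite opprK twistKV.
Qed.

Lemma weight_system_twist g (k : int) : weight_system phi T H g ->
  weight_system phi T H (twist alpha g k).
Proof.
move=> [gw g_neq0 Vg_neq0].
have twNK : twist alpha (twist alpha g k) (- k) = g.
  by rewrite -{1}[k]opprK twistKV.
split; first exact: wedge_dual_twist.
- by move=> g0; apply: g_neq0; rewrite -twNK g0.
- move=> Vg0; apply: Vg_neq0.
  rewrite -twNK -zpow_weight_space Vg0 image_set1 linear_fun0//.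
  exact: zpow_linear.
Qed.

(** The Jacobi identity is used on h1 = alpha h1', h2 = alpha h2'; applying
(h1', h2') to x, y and v in turn yields the three summands of the
eigenvalue, each times phi (T x y v) by equivariance. With T = br this
locates the brackets of root spaces, with T = rho the action of the root
spaces on the weight spaces. *)
Lemma weight_space_action (br : L -> L -> L -> L) g1 g2 g3 :
  (forall y v, linear (fun x => T x y v)) ->
  (forall x v, linear (fun y => T x y v)) ->
  (forall x y, linear (T x y)) ->
  (forall x1 x2 x3 x4 v,
    T (alpha x1) (alpha x2) (T x3 x4 v) =
      T (alpha x3) (alpha x4) (T x1 x2 v)
      + T (br x1 x2 x3) (alpha x4) (phi v)
      + T (alpha x3) (br x1 x2 x4) (phi v)) ->
  forall x y v, root_space br alpha H g1 x -> root_space br alpha H g2 y ->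
    weight_space phi T H g3 v ->
  weight_space phi T H (twist alpha (g1 + g2 + g3) (- 1)) (T x y v).
Proof.
move=> Tl Tm Tr jacobi x y v g1x g2y g3v h1 h2.
rewrite -(alpha_zpow_onN1 alpha_bij alphaH h1).
rewrite -(alpha_zpow_onN1 alpha_bij alphaH h2) jacobi g1x g2y g3v.
rewrite (linear_funZ _ _ (Tr _ _)) (linear_funZ _ _ (Tl _ _)).
rewrite (linear_funZ _ _ (Tm _ _)) !T_equivariant -!scalerDl.
by congr (_ *: _); rewrite -addrA; exact: addrC.
Qed.

End Equivariance.

(** * Products of weight spaces and eigenspaces *)

(** Since psi (a v) = phi(a) psi(v), both summands of the Leibniz rule are
multiples of psi (a v). The case V = A, with the product of A as action, is
the product of two weight spaces; V = L is the module action on root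
spaces. *)
Lemma weight_space_product (F : fieldType) (A L V : lmodType F)
    (phi : {linear A -> A}) (psi : {linear V -> V})
    (rho : L -> L -> A -> A) (T : L -> L -> V -> V) (act : A -> V -> V)
    (H : submodClosed L) (l g : sub_of H -> sub_of H -> F) :
  bilin act ->
  (forall a v, psi (act a v) = act (phi a) (psi v)) ->
  (forall x y a v,
    T x y (act a v) = act (phi a) (T x y v) + act (rho x y a) (psi v)) ->
  forall a v, weight_space phi rho H l a -> weight_space psi T H g v ->
  weight_space psi T H (l + g) (act a v).
Proof.
move=> [actl actr] psi_act leibniz a v la gv h1 h2.
rewrite leibniz la gv (linear_funZ _ _ (actr _)) (linear_funZ _ _ (actl _)).
by rewrite -psi_act -scalerDl addrC !fctE.
Qed.

(** * Root spaces and weight spaces of a split regular algebra *)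

Theorem theorem4p3 (F : fieldType) (A L : lmodType F) (mul : A -> A -> A)
    (act : A -> L -> L) (br : L -> L -> L -> L) (phi : {linear A -> A})
    (alpha : {linear L -> L}) (rho : L -> L -> A -> A) (H : submodClosed L)
    (Gamma := root_system br alpha H) (Lambda := weight_system phi rho H)
    (L_ := root_space br alpha H) (A_ := weight_space phi rho H)
    (charF0 : [pchar F] =i pred0)
    (splitL : is_split_regular mul act br phi alpha rho H)
    (g g1 g2 g3 l l1 l2 : sub_of H -> sub_of H -> F)
    (hg : (0 |` Gamma) g) (hg1 : (0 |` Gamma) g1) (hg2 : (0 |` Gamma) g2)
    (hg3 : (0 |` Gamma) g3) (hl : (0 |` Lambda) l) (hl1 : (0 |` Lambda) l1)
    (hl2 : (0 |` Lambda) l2)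
    (LLL := lspan [set u | exists x y z,
                     [/\ L_ g1 x, L_ g2 y, L_ g3 z & u = br x y z]])
    (AA := lspan [set mul a b | a in A_ l1 & b in A_ l2])
    (AL := lspan [set act a x | a in A_ l & x in L_ g])
    (LLA := lspan [set b | exists x y a,
                     [/\ L_ g1 x, L_ g2 y, A_ l a & b = rho x y a]]) :
  (* 1 *)
  (Lambda l -> forall k : int,
     Lambda (twist alpha l k) /\
     zpow phi k @` A_ l = A_ (twist alpha l (- k))) /\
  (* 2 *)
  (Gamma g -> forall k : int,
     Gamma (twist alpha g k) /\
     zpow alpha k @` L_ g = L_ (twist alpha g (- k))) /\
  (* 3 *)
  (LLL <> [set 0] ->
     (0 |` Gamma) (twist alpha (g1 + g2 + g3) (- 1)) /\
     LLL `<=` L_ (twist alpha (g1 + g2 + g3) (- 1))) /\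
  (* 4 *)
  (AA <> [set 0] ->
     (0 |` Lambda) (l1 + l2) /\ AA `<=` A_ (l1 + l2)) /\
  (* 5 *)
  (AL <> [set 0] ->
     (0 |` Gamma) (l + g) /\ AL `<=` L_ (l + g)) /\
  (* 6 *)
  (LLA <> [set 0] ->
     (0 |` Lambda) (twist alpha (g1 + g2 + l) (- 1)) /\
     LLA `<=` A_ (twist alpha (g1 + g2 + l) (- 1))).
Proof.
have [[hlr alpha_bij phi_bij] _ alphaH _ _ _] := splitL.
have [[mul_bilin _ _] lie [act_bilin _] phi_mul der rep phi_act] := hlr.
move=> leibniz _ _; have [[br1 br2 br3 _ _] br_alpha br_jacobi] := lie.
have [[[rho1 rho2] _] rho3 rho_phi _ rho_jacobi] := rep.
have br_alpha' x y z : br (alpha x) (alpha y) (alpha z) = alpha (br x y z).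
  by rewrite br_alpha.
have [wg wg1 wg2 wg3] : [/\ wedge_dual g, wedge_dual g1, wedge_dual g2
    & wedge_dual g3].
  by split; apply: (weight_system_wedge (phi := alpha) (T := br)).
have [wl wl1 wl2] : [/\ wedge_dual l, wedge_dual l1 & wedge_dual l2].
  by split; apply: (weight_system_wedge (phi := phi) (T := rho)).
(* Below, root_space br alpha H and root_system br alpha H unfold to
   weight_space alpha br H and weight_system alpha br H. *)
split; [|split; [|split; [|split; [|split]]]].
- move=> Ll k; split; first exact: weight_system_twist.
  exact: zpow_weight_space.
- move=> Gg k; split.
    exact: (weight_system_twist alpha_bij alpha_bij alphaH br_alpha').
  exact: (zpow_weight_space alpha_bij alpha_bij alphaH br_alpha').
- apply: (lspan_weight_space (phi := alpha) br3).
    by apply: wedge_dual_twist => //; do 2?apply: wedge_dualD.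
  move=> _ [x [y [z [g1x g2y g3z ->]]]].
  apply: (weight_space_action alpha_bij alphaH br_alpha' _ _ br3 _ g1x g2y g3z).
  + by move=> y' z'; exact: br1.
  + by move=> x' z'; exact: br2.
  + by move=> x1 x2 x3 x4 v; rewrite br_jacobi addrC addrA.
- apply: (lspan_weight_space rho3); first exact: wedge_dualD.
  move=> _ [a l1a [b l2b <-]].
  apply: (weight_space_product mul_bilin phi_mul _ l1a l2b) => x y.
  exact: (der x y).2.
- apply: (lspan_weight_space (phi := alpha) br3); first exact: wedge_dualD.
  move=> _ [a la [x gx <-]].
  apply: (weight_space_product act_bilin phi_act _ la gx) => x' y' b z.
  exact: leibniz.
- apply: (lspan_weight_space rho3).
    by apply: wedge_dual_twist => //; do 2?apply: wedge_dualD.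
  move=> _ [x [y [a [g1x g2y la ->]]]].
  apply: (weight_space_action alpha_bij alphaH rho_phi _ _ rho3 rho_jacobi
    g1x g2y la).
  + by move=> y' v b u w; rewrite rho1.
  + by move=> x' v b u w; rewrite rho2.
Qed.
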